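(* Let $n\ge 2$. There is a constant $c_n$ depending only on $n$ such that for every finite collection $\mathfrak{L}$ of $L$ lines in $\mathbb{R}^n$ and every integer $k\ge n$, $$|J^k(\mathfrak{L})|\le c_n\left(\frac{L^{\frac{n}{n-1}}}{k^{\frac{n+1}{n-1}}}+\frac{L}{k}\right).$$
   Context: For a finite collection $\mathfrak{L}$ of lines in $\mathbb{R}^n$: a point $x$ is a joint formed by $\mathfrak{L}$ if there are at least $n$ lines of $\mathfrak{L}$ through $x$ whose directions span $\mathbb{R}^n$. A point $x$ is a generic joint formed by $\mathfrak{L}$ if whenever $n$ lines of $\mathfrak{L}$ pass through $x$, their directions span $\mathbb{R}^n$ (i.e. they form a joint there). For $k\ge n$, $J^k(\mathfrak{L})$ denotes the set of generic joints formed by $\mathfrak{L}$ each of which lies in at least $k$ and fewer than $2k$ lines of $\mathfrak{L}$. *)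

(* Defs.v *)
From HB Require Import structures.
From mathcomp Require Import all_boot all_order all_algebra finmap.
From mathcomp Require Import all_classical all_reals all_analysis.
Set Implicit Arguments.
Unset Strict Implicit.
Unset Printing Implicit Defensive.
Import Order.TTheory GRing.Theory Num.Theory.
Local Open Scope classical_set_scope.
Local Open Scope ring_scope.

Section Joints.
Context {R : realType} {n : nat}.
Implicit Types (x p v : 'rV[R]_n) (l : set 'rV[R]_n) (LL M : {fset set 'rV[R]_n}).

Definition line p v : set 'rV[R]_n := [set p + t *: v | t in [set: R]].

(* A line has many direction vectors, all proportional to one another. *)
Definition direction l v : Prop := v != 0 /\ exists p, l = line p v.

Definition is_line l : Prop := exists v, direction l v.

Definition directions_span M : Prop :=
  exists vs : seq 'rV[R]_n,
    (forall v, v \in vs -> exists2 l, l \in M & direction l v) /\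
    <<vs>>%VS = fullv.

Definition lines_through LL x : {fset set 'rV[R]_n} := [fset l in LL | x \in l]%fset.

Definition joint LL x : Prop :=
  exists M, [/\ (M `<=` lines_through LL x)%fset, (n <= #|` M|)%N & directions_span M].

(* This holds vacuously at a point on fewer than n lines; on at least n lines
   it does imply [joint], see [generic_joint_joint]. *)
Definition generic_joint LL x : Prop :=
  forall M, (M `<=` lines_through LL x)%fset -> #|` M| = n -> directions_span M.

Definition Jk LL (k : nat) : set 'rV[R]_n :=
  [set x | generic_joint LL x /\ (k <= #|` lines_through LL x| < 2 * k)%N].

Lemma generic_joint_joint LL x :
  (n <= #|` lines_through LL x|)%N -> generic_joint LL x -> joint LL x.
Proof.
move=> len gx; set T := lines_through LL x in len *.
pose M := [fset l in take n T]%fset.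
have MT : (M `<=` T)%fset by apply/fsubsetP => l; rewrite inE => /mem_take.
have cM : #|` M| = n.
  by rewrite card_fseq undup_id ?take_uniq ?fset_uniq// size_take_min; apply/minn_idPl.
by exists M; split=> //; [rewrite cM | exact: gx].
Qed.

End Joints.

(* Main.v *)
(* Let P be a set of S generic joints, each on at least k of the L lines. By the
   argument of Quilodran, a nonzero polynomial of degree d vanishes on at most
   nLd/k points of P: otherwise, after discarding poor lines, each remaining line
   carries more than d zeros, so the gradient vanishes at the remaining joints,
   and so on by induction on the degree.

   Take d of order (S/k)^(1/n), so that the polynomials of degree O(d) form a
   space of dimension N at least a large multiple of S/k. If d is larger than a
   constant times Sk/L, this already is the required bound. Otherwise no nonzero
   polynomial of the space vanishes on more than S/8 points, which allows one to
   put the evaluation functionals at the points of P in radial isotropic position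
   (Forster, Barthe): for a suitable inner product, the squared correlations of
   a typical point with all the others sum to O(S/N), a small multiple of k.
   Hence among the roughly Sk pairs of consecutive points on the lines most are
   nearly uncorrelated, and a random polynomial changes sign on a positive
   proportion of them. As it changes sign at most O(d) times on each line, Sk is
   O(L(d + 1)), which is the required bound. *)
Require Import Defs.
From HB Require Import structures.
From mathcomp Require Import all_boot all_order all_algebra perm finmap.
From mathcomp Require Import all_classical all_reals all_analysis.
From mathcomp Require Import ring lra zify.
Set Implicit Arguments.
Unset Strict Implicit.
Unset Printing Implicit Defensive.
Import Order.TTheory GRing.Theory Num.Theory.
Import numFieldNormedType.Exports.
Local Open Scope classical_set_scope.
Local Open Scope ring_scope.

(** * Random combinations of vectors and their moments *)

(* The mean of [F] over the random combinations of the vectors of [s] whose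
   independent coefficients are 0, 1, -1 with probabilities 2/3, 1/6, 1/6: up to
   scaling, their moments of order at most 5 are those of a Gaussian. *)
Fixpoint mean {R : realType} {W : zmodType} (s : seq W) (F : W -> R) : R :=
  if s is a :: s' then
    (4 * mean s' F + mean s' (fun w => F (w + a)) + mean s' (fun w => F (w - a))) / 6
  else F 0.

Section Mean.
Context {R : realType} {W : zmodType}.
Implicit Types (s : seq W) (F H : W -> R) (f g : {additive W -> R}).

Lemma eq_mean s F H : F =1 H -> mean s F = mean s H.
Proof.
elim: s F H => [|a s IH] F H FH /=; first exact: FH.
by congr ((_ + _ + _) / _); [congr (_ * _)| |]; apply: IH => w; rewrite FH.
Qed.

Lemma le_mean s F H : (forall w, F w <= H w) -> mean s F <= mean s H.
Proof.
elim: s F H => [|a s IH] F H FH /=; first exact: FH.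
rewrite ler_pM2r ?invr_gt0 ?ltr0n// !lerD// ?ler_pM2l ?ltr0n//; exact: IH.
Qed.

Lemma mean_cst s (c : R) : mean s (fun=> c) = c.
Proof. by elim: s => //= a s ->; field. Qed.

Lemma meanD s F H : mean s (fun w => F w + H w) = mean s F + mean s H.
Proof. by elim: s F H => //= a s IH F H; rewrite !IH; field. Qed.

Lemma meanZ s (c : R) F : mean s (fun w => c * F w) = c * mean s F.
Proof. by elim: s F => //= a s IH F; rewrite !IH; field. Qed.

Lemma mean_sum s (I : Type) (r : seq I) (P : pred I) (F : I -> W -> R) :
  mean s (fun w => \sum_(i <- r | P i) F i w) = \sum_(i <- r | P i) mean s (F i).
Proof.
elim: r => [|i r IH].
  by rewrite big_nil -[RHS](mean_cst s); apply: eq_mean => w; rewrite big_nil.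
rewrite big_cons -IH; case: ifP => Pi; rewrite -?meanD;
  by apply: eq_mean => w; rewrite big_cons Pi.
Qed.

Lemma mean_le_exists s F (c : R) : c <= mean s F -> exists w, c <= F w.
Proof.
elim: s F => [|a s IH] F /= h; first by exists 0.
have [|h1] := leP c (mean s F); first exact: IH.
have [|h2] := leP c (mean s (fun w => F (w + a))); first by case/IH => w; exists (w + a).
have [|h3] := leP c (mean s (fun w => F (w - a))); first by case/IH => w; exists (w - a).
by exfalso; lra.
Qed.

(** The new coefficient is averaged innermost here, so that the inductive steps for moments become
    pointwise identities. *)
Lemma mean_cons s a F : mean (a :: s) F =
  mean s (fun w => (4 * F w + F (w + a) + F (w - a)) / 6).
Proof.
rewrite /= mulrC -meanZ -!meanD -meanZ.
by apply: eq_mean => w; rewrite mulrC.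
Qed.

Lemma mean_mul f g s :
  mean s (fun w => f w * g w) = (\sum_(a <- s) f a * g a) / 3.
Proof.
elim: s => [|a s IH]; first by rewrite /= !raddf0 big_nil; field.
rewrite mean_cons big_cons mulrDl -IH -[f a * g a / 3](mean_cst s) -meanD.
by apply: eq_mean => w; rewrite !raddfB !raddfD /=; field.
Qed.

Lemma mean_sqr f s : mean s (fun w => f w ^+ 2) = (\sum_(a <- s) f a ^+ 2) / 3.
Proof. exact: mean_mul. Qed.

(** This is Wick's formula. It is exact because a coefficient has variance 1/3 and fourth moment 1/3
    = 3 (1/3)^2, the Gaussian value. *)
Lemma mean_sqr_sqr f g s :
  mean s (fun w => f w ^+ 2 * g w ^+ 2) =
  ((\sum_(a <- s) f a ^+ 2) * (\sum_(a <- s) g a ^+ 2) +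
   2 * (\sum_(a <- s) f a * g a) ^+ 2) / 9.
Proof.
elim: s => [|a s IH]; first by rewrite /= !raddf0 !big_nil; field.
rewrite mean_cons !big_cons.
transitivity (mean s (fun w => f w ^+ 2 * g w ^+ 2 + (g a ^+ 2 / 3) * f w ^+ 2
   + (f a ^+ 2 / 3) * g w ^+ 2 + (4 * f a * g a / 3) * (f w * g w)
   + (f a ^+ 2 * g a ^+ 2 / 3))).
  by apply: eq_mean => w; rewrite !raddfB !raddfD /=; field.
by rewrite !meanD !meanZ mean_cst IH !mean_sqr mean_mul; field.
Qed.

(** The bounds are the Gaussian moments 3, 15 and 105 times powers of the variance [A / 3]. In the
    induction odd terms cancel and every even moment of a coefficient is 1/3, which gives the
    factors binomial(m, 2j) / 3 below. *)
Lemma mean_moments f s : let A := \sum_(a <- s) f a ^+ 2 in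
  [/\ mean s (fun w => f w ^+ 4) <= A ^+ 2 / 3,
      mean s (fun w => f w ^+ 6) <= 5 / 9 * A ^+ 3 &
      mean s (fun w => f w ^+ 8) <= 35 / 27 * A ^+ 4].
Proof.
elim: s => [|a s].
  by rewrite /= !raddf0 big_nil !expr0n /=; split; lra.
set A := \sum_(a <- s) _ => -[m4 m6 m8].
have A0 : 0 <= A by apply: sumr_ge0 => i _; exact: sqr_ge0.
rewrite !mean_cons !big_cons -/A.
set x := f a ^+ 2.
have x0 : 0 <= x by exact: sqr_ge0.
have m2 : mean s (fun w => f w ^+ 2) = A / 3 by exact: mean_sqr.
split.
- rewrite [leLHS](_ : _ = mean s (fun w => f w ^+ 4 + 2 * x * f w ^+ 2 + x ^+ 2 / 3)); last first.
    by apply: eq_mean => w; rewrite !raddfB !raddfD /= /x; field.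
  by rewrite !meanD !meanZ mean_cst m2; nra.
- rewrite [leLHS](_ : _ = mean s (fun w => f w ^+ 6 + 5 * x * f w ^+ 4 +
      5 * x ^+ 2 * f w ^+ 2 + x ^+ 3 / 3)); last first.
    by apply: eq_mean => w; rewrite !raddfB !raddfD /= /x; field.
  rewrite !meanD !meanZ mean_cst m2.
  have := ler_wpM2l x0 m4; have : 0 <= x ^+ 3 by rewrite exprn_ge0.
  by nra.
- rewrite [leLHS](_ : _ = mean s (fun w => f w ^+ 8 + (28 / 3) * x * f w ^+ 6 +
      (70 / 3) * x ^+ 2 * f w ^+ 4 + (28 / 3) * x ^+ 3 * f w ^+ 2 + x ^+ 4 / 3)); last first.
    by apply: eq_mean => w; rewrite !raddfB !raddfD /= /x; field.
  rewrite !meanD !meanZ mean_cst m2.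
  have := ler_wpM2l x0 m6; have := ler_wpM2l (sqr_ge0 x) m4.
  have : 0 <= x ^+ 4 by rewrite exprn_ge0.
  have : 0 <= x ^+ 3 * A by rewrite mulr_ge0// exprn_ge0.
  by nra.
Qed.

(* On [z >= 0] the polynomial [z^2 - (3/70) z^4 - 2 z] is nonpositive and on
   [z < 0] it is at most 18, while its mean is bounded below by the moments. *)
Lemma mean_sign_change f g s :
  \sum_(a <- s) f a ^+ 2 = 1 -> \sum_(a <- s) g a ^+ 2 = 1 ->
  \sum_(a <- s) f a * g a <= 1 / 24 ->
  1 / 648 <= mean s (fun w => (f w * g w < 0)%R%:R : R).
Proof.
move=> f1 g1 fg.
pose q (z : R) := (z ^+ 2 - 3 / 70 * z ^+ 4 - 2 * z) / 18.
have qle z : q z <= (z < 0)%R%:R.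
  rewrite /q; have [z0|z0] := ltP z 0; rewrite ?mulr1n ?mulr0n.
    suff : z ^+ 2 - 3 / 70 * z ^+ 4 - 2 * z <= 18 by lra.
    have := sqr_ge0 (z ^+ 2 - 13); have := sqr_ge0 (z + 18/5); nra.
  suff : z ^+ 2 - 3 / 70 * z ^+ 4 - 2 * z <= 0 by lra.
  suff : 0 <= z * (2 + 3 / 70 * z ^+ 3 - z) by nra.
  apply: mulr_ge0 => //.
  have := sqr_ge0 (z - 14/5); have := mulr_ge0 z0 (sqr_ge0 (z - 14/5)); nra.
apply: (@le_trans _ _ (mean s (fun w => q (f w * g w)))); last by apply: le_mean => w; exact: qle.
have m8 (h : {additive W -> R}) : \sum_(a <- s) h a ^+ 2 = 1 ->
    mean s (fun w => h w ^+ 8) <= 35 / 27.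
  by move=> h1; have [_ _] := mean_moments h s; rewrite h1 expr1n mulr1.
have : mean s (fun w => f w ^+ 4 * g w ^+ 4) <=
       mean s (fun w => 1 / 2 * f w ^+ 8 + 1 / 2 * g w ^+ 8).
  by apply: le_mean => w; have := sqr_ge0 (f w ^+ 4 - g w ^+ 4); nra.
rewrite meanD !meanZ => m4; have m8f := m8 _ f1; have m8g := m8 _ g1.
have m2 := mean_sqr_sqr f g s; rewrite f1 g1 in m2.
have m1 := mean_mul f g s.
rewrite [leRHS](_ : _ = mean s (fun w => (1/18) * (f w ^+ 2 * g w ^+ 2) +
   (- (1 / 420)) * (f w ^+ 4 * g w ^+ 4) + (- (1/9)) * (f w * g w))); last first.
  by apply: eq_mean => w; rewrite /q; field.
(* The mean of f^2 g^2 is at least 1/9, so the lower bound is 1/162 - 1/324 - 1/648 = 1/648. *)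
rewrite !meanD !meanZ m1 m2.
have := sqr_ge0 (\sum_(a <- s) f a * g a); lra.
Qed.

End Mean.

(** * Continuity, an elementary determinant and a tangency criterion *)

Section Continuity.
Context {R : realType} {V : topologicalType}.
Implicit Types f g : V -> R.

Lemma continuous_add f g : continuous f -> continuous g -> continuous (fun w => f w + g w).
Proof. by move=> cf cg w; apply: cvgD; [exact: cf | exact: cg]. Qed.

Lemma continuous_mul f g : continuous f -> continuous g -> continuous (fun w => f w * g w).
Proof. by move=> cf cg w; apply: cvgM; [exact: cf | exact: cg]. Qed.

Lemma continuous_sum (I : finType) (F : I -> V -> R) :
  (forall i, continuous (F i)) -> continuous (fun w => \sum_i F i w).
Proof.
move=> cF; apply: continuous_big => [z|i _]; last exact: cF.
by apply: cvgD; [exact: cvg_fst | exact: cvg_snd].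
Qed.

Lemma continuous_prod (I : finType) (F : I -> V -> R) :
  (forall i, continuous (F i)) -> continuous (fun w => \prod_i F i w).
Proof.
move=> cF; apply: continuous_big => [z|i _]; last exact: cF.
by apply: cvgM; [exact: cvg_fst | exact: cvg_snd].
Qed.

End Continuity.

(** The determinant is linear in row [i]. Replacing that row of the identity by the [j]-th unit row
    gives [C], which has two equal rows unless i = j. *)
Lemma det_1_delta {R : comNzRingType} {N} (i j : 'I_N) (t : R) :
  \det (1%:M + t *: delta_mx i j) = 1 + (i == j)%:R * t.
Proof.
pose C : 'M[R]_N := \matrix_(k, l) (if k == i then j == l else k == l)%:R.
rewrite (@determinant_multilinear _ _ _ 1%:M C i 1 t).
- rewrite det1 mul1r [_ * t]mulrC; congr (_ + t * _).
  have [eij|ij] := eqVneq i j.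
    rewrite -[RHS](det1 R N); congr (\det _); apply/matrixP => k l.
    by rewrite !mxE; case: eqVneq => // ->; rewrite eij.
  apply: (determinant_alternate ij) => l.
  by rewrite !mxE eqxx; case: ifP.
- by apply/rowP => l; rewrite !mxE !eqxx mul1r (eq_sym l).
- by apply/matrixP => k l; rewrite !mxE [_ == i]eq_sym (negbTE (neq_lift _ _)) ?mulr0 ?addr0.
- by apply/matrixP => k l; rewrite !mxE [_ == i]eq_sym (negbTE (neq_lift _ _)) ?mulr0 ?addr0.
Qed.

(** Both sides vanish at t = 0 with slopes [2 * a] and [2 * c], so an inequality on both sides of 0
    forces the slopes to agree. A small explicit [t] of the right sign replaces differentiation. *)
Lemma first_order {R : realType} (a c : R) : 0 <= c ->
  (forall t, -1 < t -> 2 * a * (t / (1 + t)) <= (2 * t + t ^+ 2) * c) -> c = a.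
Proof.
move=> c0 h; apply/eqP; rewrite eq_le; apply/andP; split; rewrite leNgt; apply/negP => lt.
  pose t : R := - ((c - a) / (8 * (c + `|a| + 1))).
  have := ler_norm a; have := ler_norm (- a); rewrite normrN => a1 a2.
  have t1 : t * (8 * (c + `|a| + 1)) = - (c - a) by rewrite /t; field; lra.
  have t0 : t < 0 by rewrite oppr_lt0 divr_gt0//; lra.
  have tm : - (1/8) <= t by rewrite -(ler_pM2r (_ : 0 < 8 * (c + `|a| + 1))) ?t1; lra.
  have := h t; rewrite mulrA ler_pdivrMr; last by lra.
  have -> : (2 * t + t ^+ 2) * c * (1 + t) = t * ((2 + t) * (1 + t) * c) by ring.
  have -> : 2 * a * t = t * (2 * a) by ring.
  rewrite ler_nM2l// => /(_ ltac:(lra)).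
  nra.
pose t : R := (a - c) / (8 * (a + 1)).
have t1 : t * (8 * (a + 1)) = a - c by rewrite /t; field; lra.
have t0 : 0 < t by rewrite divr_gt0//; lra.
have := h t; rewrite mulrA ler_pdivrMr; last by lra.
have -> : (2 * t + t ^+ 2) * c * (1 + t) = t * ((2 + t) * (1 + t) * c) by ring.
have -> : 2 * a * t = t * (2 * a) by ring.
have t8 : t <= 1 / 8 by rewrite -(ler_pM2r (_ : 0 < 8 * (a + 1))) ?t1; lra.
rewrite ler_pM2l// => /(_ ltac:(lra)).
have := mulr_ge0 (ltW t0) c0; nra.
Qed.

(** * Radial isotropic position by maximizing a potential *)

Section Isotropy.
Context {R : realType} {N S : nat} (E : 'M[R]_(N, S)).

(* The columns of [E] are the evaluations at the points; [G] is the coefficient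
   matrix of an orthonormal basis for the sought inner product. The summand 1
   in [weight] keeps the potential continuous when all of [G *m E] vanishes at a point. *)
Definition weight (G : 'M[R]_N) (x : 'I_S) : R := 1 + \sum_i (G *m E) i x ^+ 2.

(** Scaling [G] by r multiplies the numerator by r^(6NS). Since at least 7/8 of the points keep a
    large weight, the denominator grows at least like r^(7NS), so the potential stays small far
    away. The ratio of the two exponents reappears in the isotropy constant. *)
Definition potential (G : 'M[R]_N) : R :=
  (\det G ^+ 2) ^+ (3 * S) / (\prod_x weight G x) ^+ (4 * N).

Lemma weight_ge1 G x : 1 <= weight G x.
Proof. by rewrite lerDl sumr_ge0// => i _; exact: sqr_ge0. Qed.

Lemma weight_gt0 G x : 0 < weight G x.
Proof. exact: lt_le_trans (weight_ge1 G x). Qed.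

Lemma prod_weight_gt0 G : 0 < \prod_x weight G x.
Proof. by apply: prodr_gt0 => x _; exact: weight_gt0. Qed.

Lemma le_prod_weight G x0 (A : {set 'I_S}) :
  (forall x, x \in A -> x0 <= weight G x) -> 0 <= x0 ->
  x0 ^+ #|A| <= \prod_x weight G x.
Proof.
move=> Ax x00; rewrite (bigID [in A])/= -[leLHS]mulr1 ler_pM ?exprn_ge0//.
  by rewrite -prodr_const; apply: ler_prod => x xA; rewrite x00/=; exact: Ax.
by apply: (big_ind (fun z => 1 <= z)) => // [y z|x _]; [exact: mulr_ege1 | exact: weight_ge1].
Qed.

Lemma continuous_potential :
  continuous (fun w : 'rV[R]_(N * N) => potential (vec_mx w)).
Proof.
have cG i j : continuous (fun w : 'rV[R]_(N * N) => vec_mx w i j).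
  rewrite (_ : (fun w => _) = fun w : 'rV[R]_(N * N) => w ord0 (mxvec_index i j)).
    exact: coord_continuous.
  by apply/funext => w; rewrite mxE.
have cX (h : 'rV[R]_(N * N) -> R) m : continuous h -> continuous (fun w => h w ^+ m).
  move=> ch w; apply: (@continuous_comp _ _ _ h (fun z => z ^+ m)); first exact: ch.
  exact: exprn_continuous.
have cW x : continuous (fun w : 'rV[R]_(N * N) => weight (vec_mx w) x).
  apply: (@continuous_add _ _ (fun=> 1)); first exact: cst_continuous.
  apply: continuous_sum => i; apply: (cX (fun w => (vec_mx w *m E) i x)).
  rewrite (_ : (fun w => _) = (fun w : 'rV[R]_(N * N) => \sum_j vec_mx w i j * E j x)).
    by apply: continuous_sum => j; apply: continuous_mul; [exact: cG | exact: cst_continuous].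
  by apply/funext => v; rewrite mxE.
have cD : continuous (fun w : 'rV[R]_(N * N) => \det (vec_mx w)).
  apply: continuous_sum => s; apply: continuous_mul; first exact: cst_continuous.
  by apply: continuous_prod => i; exact: cG.
apply: continuous_mul; first exact: (cX (fun w => (\det (vec_mx w)) ^+ 2) _ (cX _ 2 cD)).
have cP : continuous (fun w : 'rV[R]_(N * N) => (\prod_x weight (vec_mx w) x) ^+ (4 * N)).
  by apply: cX; apply: continuous_prod => x; exact: cW.
move=> w; apply: (cvgV _ (cP w)).
by rewrite expf_neq0// gt_eqF// prod_weight_gt0.
Qed.

Lemma det_le (G : 'M[R]_N) (r : R) : (forall i j, `|G i j| <= r) -> `|\det G| <= (N`!)%:R * r ^+ N.
Proof.
move=> Gr; have -> : (N`!)%:R * r ^+ N = \sum_(s : 'S_N) r ^+ N.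
  by rewrite sumr_const card_Sn mulr_natl.
apply: (le_trans (ler_norm_sum _ _ _)); apply: ler_sum => s _.
rewrite normrM normrX normrN1 expr1n mul1r normr_prod -[N in leRHS]card_ord -prodr_const.
by apply: ler_prod => i _; rewrite normr_ge0 Gr.
Qed.

Hypothesis few_zeros : forall c : 'rV[R]_N, c != 0 ->
  (8 * #|[pred x | ((c *m E) ord0 x == 0)%R]| <= S)%N.

(* Compactness of the unit sphere, obtained from left inverses: a vector with
   too many small values would be recovered from them. *)
Lemma few_small_values : exists2 d : R, 0 < d & forall (c : 'rV[R]_N) j,
  (8 * #|[pred x | (`|(c *m E) ord0 x| < d * `|c ord0 j|)%R]| <= S)%N.
Proof.
pose ET (T : {set 'I_S}) := \matrix_(i, x) (if x \in T then E i x else 0).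
pose B T := pinvmx (ET T).
(* Summing over all subsets [T] makes the threshold independent of [c]. *)
pose C := \sum_T \sum_x \sum_j `|B T x j|.
have C0 : 0 <= C by apply: sumr_ge0 => T _; do 2! apply: sumr_ge0 => ? _.
exists (1 + C)^-1 => [|c j]; first by rewrite invr_gt0; lra.
rewrite -cardsE; set T := [set x | _]%SET; rewrite leqNgt; apply/negP => ST.
have cET x : (c *m ET T) ord0 x = if x \in T then (c *m E) ord0 x else 0.
  rewrite mxE; case: ifPn => xT; last first.
    by rewrite big1// => i _; rewrite mxE (negbTE xT) mulr0.
  by rewrite mxE; apply: eq_bigr => i _; rewrite mxE xT.
(* A coefficient vector killed by [ET T] vanishes at all points of [T], which are more than S/8. *)
have fr : row_free (ET T).
  apply: inj_row_free => u uE0; apply/eqP; apply: contraT => /few_zeros.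
  rewrite leqNgt => /negP; case; apply: (leq_trans ST).
  rewrite leq_mul2l/= subset_leq_card//; apply/fintype.subsetP => x xT; rewrite inE.
  have /matrixP/(_ ord0 x) := uE0; rewrite [RHS]mxE => <-.
  rewrite !mxE; apply/eqP/eq_bigr => i _; by rewrite mxE xT.
have cj0 : 0 < `|c ord0 j|.
  rewrite lt_neqAle normr_ge0 andbT; apply/eqP => cj0.
  suff T0 : T = finset.set0 by rewrite T0 cards0 muln0 in ST.
  by apply/setP => x; rewrite !inE -cj0 mulr0 ltNge normr_ge0.
have : c ord0 j = \sum_x (c *m ET T) ord0 x * B T x j.
  by rewrite -{1}[c]mulmx1 -(mulmxVp fr) mulmxA mxE.
move/(congr1 Num.norm) => cE.
have : `|c ord0 j| <= \sum_x ((1 + C)^-1 * `|c ord0 j|) * `|B T x j|.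
  rewrite [leLHS]cE; apply: (le_trans (ler_norm_sum _ _ _)); apply: ler_sum => x _.
  rewrite normrM ler_wpM2r// cET; case: ifPn => [|_].
    by rewrite inE => /ltW.
  by rewrite normr0 mulr_ge0// invr_ge0; lra.
rewrite -mulr_sumr.
have : \sum_x `|B T x j| <= C.
  rewrite /C (bigD1 T)//= -[leLHS]addr0 lerD//; last first.
    by apply: sumr_ge0 => ? _; do 2! apply: sumr_ge0 => ? _.
  apply: ler_sum => x _; rewrite (bigD1 j)//= lerDl.
  exact: sumr_ge0.
set b := \sum_x _ => bC; rewrite leNgt => /negP; apply.
rewrite -[ltRHS]mul1r mulrAC ltr_pM2r// mulrC ltr_pdivrMr; lra.
Qed.

Hypothesis S_gt0 : (0 < S)%N.
Hypothesis N_gt0 : (0 < N)%N.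

(** Outside a large box of matrix entries the potential is at most its value at the identity; on the
    compact box it attains a maximum. *)
Lemma potential_max : exists G, 0 < potential G /\ forall G', potential G' <= potential G.
Proof.
have [d d0 small] := few_small_values.
have pot1 : 0 < potential 1%:M.
  by rewrite /potential det1 !expr1n mul1r invr_gt0 exprn_gt0// prod_weight_gt0.
(* For r > [M] the second summand gives [d * r >= 1]; the third lets the spare factor r^(NS) >= r,
   left between r^(6NS) and r^(7NS), absorb the constants. *)
pose M := 1 + d^-1 + ((N`!)%:R ^+ (6 * S) * d^-1 ^+ (7 * N * S)) / potential 1%:M.
have d10 : 0 < d^-1 by rewrite invr_gt0.
have Mt : 0 <= ((N`!)%:R ^+ (6 * S) * d^-1 ^+ (7 * N * S)) / potential 1%:M.
  by rewrite divr_ge0 ?(ltW pot1)// mulr_ge0// exprn_ge0// ltW.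
have M1 : 1 <= M by rewrite /M; lra.
have far (G : 'M[R]_N) : ~ (forall i j, `|G i j| <= M) -> potential G <= potential 1%:M.
  move=> /existsNP[i0 /existsNP[j0 /negP]]; rewrite -ltNge => MG.
  have [[i j] _ /= Gmax] := @Order.TotalTheory.arg_maxP _ _ _ (i0, j0) xpredT
    (fun ij => `|G ij.1 ij.2|) isT.
  set r := `|G i j| in Gmax.
  have Mr : M < r by rewrite (lt_le_trans MG)//; exact: (Gmax (i0, j0)).
  have r0 : 0 < r by rewrite (lt_trans _ Mr)//; lra.
  have dr1 : 1 <= d * r.
    rewrite -ler_pdivrMl// mulr1 (le_trans _ (ltW Mr))// /M; lra.
  have detG := det_le (fun i j => Gmax (i, j) isT).
  (* Row [i] contains the largest entry r of [G]. Off the few points of [T], this row alone makes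
     the weight at least [(d * r) ^+ 2]. *)
  pose T := [set x | `|(row i G *m E) ord0 x| < d * `|row i G ord0 j| ]%SET.
  pose A := (~: T)%SET.
  have cA : (7 * S <= 8 * #|A|)%N.
    have : (8 * #|T| <= S)%N by rewrite cardsE; exact: small.
    by have := cardsC T; rewrite card_ord -/A; clear; lia.
  have Aw x : x \in A -> (d * r) ^+ 2 <= weight G x.
    rewrite !inE -leNgt [row i G _ _]mxE -row_mul mxE -/r => ge.
    rewrite /weight (bigD1 i)//=.
    apply: (@le_trans _ _ ((G *m E) i x ^+ 2)).
      by rewrite -[leRHS]real_normK ?num_real// lerXn2r// nnegrE mulr_ge0// ltW.
    have : 0 <= \sum_(k | k != i) (G *m E) k x ^+ 2.
      by apply: sumr_ge0 => k _; exact: sqr_ge0.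
    by lra.
  have pw := le_prod_weight Aw (sqr_ge0 _).
  rewrite /potential ler_pdivrMr ?exprn_gt0 ?prod_weight_gt0//.
  apply: (@le_trans _ _ (((N`!)%:R * r ^+ N) ^+ (6 * S))).
    rewrite -(real_normK (num_real (\det G))) -exprM mulnA.
    by rewrite lerXn2r// nnegrE mulr_ge0// exprn_ge0// ltW.
  apply: (@le_trans _ _ (potential 1%:M * (d * r) ^+ (7 * N * S))); last first.
    rewrite ler_pM2l//.
    apply: (@le_trans _ _ (((d * r) ^+ 2) ^+ #|A| ^+ (4 * N))).
      rewrite -!exprM ler_weXn2l//.
      by have := leq_mul (leqnn N) cA; clear; lia.
    apply: lerXn2r => //; rewrite nnegrE; first exact/exprn_ge0/sqr_ge0.
    exact/ltW/prod_weight_gt0.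
  rewrite exprMn -exprM.
  have NS : (7 * N * S = N * (6 * S) + (N * S).-1.+1)%N.
    by rewrite prednK ?muln_gt0 ?N_gt0//; clear; lia.
  have rNS : r <= r ^+ (N * S).-1.+1.
    by rewrite exprS ler_peMr ?(ltW r0)// exprn_ege1// (le_trans M1)// ltW.
  have pr : (N`!)%:R ^+ (6 * S) * d^-1 ^+ (7 * N * S) <= potential 1%:M * r ^+ (N * S).-1.+1.
    rewrite -ler_pdivrMl//; apply: (le_trans _ rNS); apply: (le_trans _ (ltW Mr)).
    by rewrite mulrC lerDr addr_ge0// ltW.
  rewrite exprMn {2}NS exprD [leRHS](_ : _ = r ^+ (N * (6 * S)) * (d ^+ (7 * N * S) *
    (potential 1%:M * r ^+ (N * S).-1.+1))); last by ring.
  by rewrite [leLHS]mulrC ler_pM2l ?exprn_gt0// -ler_pdivrMl ?exprn_gt0// -exprVn mulrC.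
pose box := [set w : 'rV[R]_(N * N) | forall i, `[- M, M]%classic (w ord0 i)].
have [w wbox wmax] : exists2 w, w \in box &
    forall t, t \in box -> potential (vec_mx t) <= potential (vec_mx w).
  apply: EVT_max_rV.
  - by exists 0 => i /=; rewrite mxE in_itv/=; lra.
  - by apply: (@rV_compact _ _ (fun=> `[- M, M]%classic)) => _; exact: segment_compact.
  - by apply: continuous_subspaceT; exact: continuous_potential.
have near (G : 'M[R]_N) : (forall i j, `|G i j| <= M) -> potential G <= potential (vec_mx w).
  move=> GM; rewrite -{1}[G]mxvecK; apply: wmax; rewrite inE => k /=.
  by case/mxvec_indexP: k => i j; rewrite mxvecE in_itv/= -ler_norml.
have pot1w : potential 1%:M <= potential (vec_mx w).
  by apply: near => i j; rewrite mxE; case: (i == j); rewrite ?normr1 ?normr0//; lra.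
exists (vec_mx w); split; first exact: lt_le_trans pot1w.
move=> G; have [/near//|/far/le_trans] := pselect (forall i j, `|G i j| <= M); exact.
Qed.

(* First-order conditions at a maximum of the potential, along the elementary
   row operations [1 + t *: delta_mx i j]. *)
Lemma isotropic_position : exists G : 'M[R]_N, forall i j,
  \sum_x (G *m E) i x * (G *m E) j x / weight G x =
  (i == j)%:R * (3 * S)%:R / (4 * N)%:R.
Proof.
have [G [G0 Gmax]] := potential_max.
exists G; set H := G *m E; pose a := weight G.
pose m i j := \sum_x H i x * H j x / a x.
have detG : 0 < \det G ^+ 2.
  rewrite lt_neqAle sqr_ge0 andbT eq_sym; apply/eqP => d0.
  by move: G0; rewrite /potential d0 expr0n muln_eq0/= gtn_eqF// mul0r ltxx.
pose U i j (t : R) : 'M[R]_N := 1%:M + t *: delta_mx i j.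
have UE i j t k x : (U i j t *m G *m E) k x = H k x + (k == i)%:R * t * H j x.
  rewrite -mulmxA -/H mulmxDl mul1mx mxE -scalemxAl; congr (_ + _).
  rewrite mxE mxE (bigD1 j)//= mxE eqxx andbT big1 ?addr0 => [|l lj].
    by rewrite mulrCA mulrA.
  by rewrite mxE (negbTE lj) andbF mul0r.
have Ua i j t x : weight (U i j t *m G) x / a x =
    1 + (2 * t * (H i x * H j x / a x) + t ^+ 2 * (H j x * H j x / a x)).
  rewrite /weight (bigD1 i)//= UE eqxx mul1r.
  rewrite (eq_bigr (fun k => H k x ^+ 2)) => [|k ki]; last first.
    by rewrite UE (negbTE ki) !mul0r addr0.
  have ax0 : a x != 0 by rewrite gt_eqF// weight_gt0.
  have -> : \sum_(k | k != i) H k x ^+ 2 = a x - 1 - H i x ^+ 2.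
    by rewrite /a /weight [in RHS](bigD1 i)//= -/H; ring.
  by field.
(* Maximality bounds the change of the determinant by the product of the weight ratios, and 1 + x <=
   exp x turns that product into the exponential of a sum. *)
have key i j t : (\det (U i j t) ^+ 2) ^+ (3 * S) <=
    expR ((4 * N)%:R * (2 * t * m i j + t ^+ 2 * m j j)).
  have prodE : \prod_x weight (U i j t *m G) x / \prod_x a x <=
      expR (2 * t * m i j + t ^+ 2 * m j j).
    rewrite -prodf_div /m !mulr_sumr -big_split/= expR_sum.
    apply: ler_prod => x _; rewrite divr_ge0 ?(ltW (weight_gt0 _ _))//= Ua.
    exact: expR_ge1Dx.
  have X0 : 0 < (\det G ^+ 2) ^+ (3 * S) by exact: exprn_gt0.
  have E2 (y z : R) : ((y * z) ^+ 2) ^+ (3 * S) = (y ^+ 2) ^+ (3 * S) * (z ^+ 2) ^+ (3 * S).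
    by rewrite -!exprM exprMn.
  have := Gmax (U i j t *m G).
  rewrite /potential det_mulmx E2 ler_pdivrMr ?exprn_gt0 ?prod_weight_gt0// => h.
  rewrite -(ler_pM2r X0); apply: (le_trans h).
  rewrite mulrC mulrCA mulrC ler_pM2r// -expr_div_n expRM_natl.
  apply: lerXn2r => //; rewrite nnegrE ?expR_ge0//.
  by rewrite divr_ge0// ltW// prod_weight_gt0.
have m_ge0 j : 0 <= m j j.
  by apply: sumr_ge0 => x _; rewrite divr_ge0 ?(ltW (weight_gt0 _ _))// -expr2 sqr_ge0.
have N40 : 0 < (4 * N)%:R :> R by rewrite ltr0n muln_gt0.
move=> i j; rewrite -/(m i j); have [<-{j}|ij] := eqVneq i j; last first.
  rewrite !mul0r.
  have detU t : \det (U i j t) = 1 by rewrite det_1_delta (negbTE ij) mul0r addr0.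
  have q t : 0 <= 2 * t * m i j + t ^+ 2 * m j j.
    have := key i j t; rewrite detU !expr1n -[leLHS]expR0 ler_expR.
    by rewrite pmulr_rge0.
  have mj0 := m_ge0 j; set b := m i j in q *; set c := m j j in q mj0.
  (* The quadratic has no constant term and is never negative, so its linear coefficient vanishes.
     The denominator c + 1 allows for c = 0. *)
  have := q (- b / (c + 1)); have c1 : 0 < c + 1 by lra.
  rewrite (_ : _ + _ = - (b ^+ 2 * (c + 2) / (c + 1) ^+ 2)); last by field; lra.
  rewrite oppr_ge0 pmulr_lle0 ?invr_gt0 ?exprn_gt0// pmulr_lle0; last by lra.
  by move=> b0; apply/eqP; rewrite -sqrf_eq0 eq_le b0 sqr_ge0.
have detU t : \det (U i i t) = 1 + t by rewrite det_1_delta eqxx mul1r.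
have q t : -1 < t -> (6 * S)%:R * (t / (1 + t)) <= (4 * N)%:R * ((2 * t + t ^+ 2) * m i i).
  move=> t1; rewrite mulrDl -ler_expR.
  apply: le_trans (key i i t); rewrite detU -exprM mulnA expRM_natl.
  rewrite lerXn2r// ?nnegrE ?expR_ge0//; first by lra.
  (* Inverting this gives exp (t / (1 + t)) <= 1 + t, a lower bound for the determinant. *)
  have := expR_ge1Dx (- (t / (1 + t))); rewrite expRN.
  have t0 : 0 < 1 + t by lra.
  have -> : 1 + - (t / (1 + t)) = (1 + t)^-1 by field; lra.
  by rewrite lef_pV2// posrE expR_gt0.
have S0 : 0 < S%:R :> R by rewrite ltr0n.
have N0 : 0 < N%:R :> R by rewrite ltr0n.
rewrite mul1r; set c := m i i in q *; have c0 : 0 <= c by exact: m_ge0.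
apply: first_order => // t t1.
rewrite -(ler_pM2l N40); apply: le_trans (q t t1).
rewrite le_eqVlt; apply/orP; left; apply/eqP.
by rewrite !natrM; field; apply/andP; split; lra.
Qed.

End Isotropy.

(** * Sign changes on nearly uncorrelated pairs *)

Section ManySignChanges.
Context {R : realType} {N S : nat} (E : 'M[R]_(N, S)).
Hypothesis few_zeros : forall c : 'rV[R]_N, c != 0 ->
  (8 * #|[pred x | ((c *m E) ord0 x == 0)%R]| <= S)%N.
Hypotheses (S_gt0 : (0 < S)%N) (N_gt0 : (0 < N)%N).

(** For [r] the norm of the evaluation at [x] this is a unit functional. The additive structure
    registered below lets the moment lemmas apply to it. *)
Definition scaled_eval (x : 'I_S) (r : R) (c : 'rV[R]_N) : R := (c *m E) ord0 x / r.

Lemma scaled_eval_is_zmod_morphism x r : zmod_morphism (scaled_eval x r).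
Proof. by move=> c d; rewrite /scaled_eval mulmxBl !mxE mulrBl. Qed.

HB.instance Definition _ x r :=
  GRing.isZmodMorphism.Build _ _ (scaled_eval x r) (scaled_eval_is_zmod_morphism x r).

(* In isotropic position the squared correlations of a point of [A] with the others
   sum to at most 3S/2N, so most pairs of [Ed] are nearly uncorrelated, and a
   random combination of the basis changes sign on such a pair with probability
   at least 1/648. *)
Lemma many_sign_changes : exists2 A : {set 'I_S}, (S <= 2 * #|A|)%N &
  forall Ed : {set 'I_S * 'I_S}, (forall e, e \in Ed -> e.1 \in A /\ e.2 \in A) ->
  exists c : 'rV[R]_N,
    (#|Ed|%:R - 864 * S%:R / N%:R * #|A|%:R) / 648 <=
    #|[set e in Ed | (c *m E) ord0 e.1 * (c *m E) ord0 e.2 < 0]%SET|%:R :> R.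
Proof.
have [G isoG] := isotropic_position few_zeros S_gt0 N_gt0.
set H := G *m E in isoG; pose a := weight E G.
pose s x := \sum_i H i x ^+ 2; pose k : R := (3 * S)%:R / (4 * N)%:R.
have aE x : a x = 1 + s x by [].
have s0 x : 0 <= s x by apply: sumr_ge0 => i _; exact: sqr_ge0.
have a0 x : 0 < a x by exact: weight_gt0.
have N0 : 0 < N%:R :> R by rewrite ltr0n.
have k0 : 0 <= k by rewrite divr_ge0.
(* The ratio [s x / a x] is below 1/2 off [A] and below 1 on [A]. These ratios sum to 3S/4, so [A]
   contains at least half of the points. *)
pose A := [set x | 1 <= s x]%SET.
have trace : \sum_x s x / a x = 3 / 4 * S%:R.
  under eq_bigr do rewrite mulr_suml.
  rewrite exchange_big/= (eq_bigr (fun=> k)) => [|i _].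
    by rewrite sumr_const card_ord /k -mulr_natl !natrM; field; lra.
  rewrite -(eq_bigr _ (fun x _ => erefl (H i x * H i x / a x))).
  by rewrite isoG eqxx mul1r.
exists A.
  rewrite -(ler_nat R) natrM.
  have : \sum_x s x / a x <= \sum_x (1 / 2 + (x \in A)%:R / 2).
    apply: ler_sum => x _; rewrite ler_pdivrMr// aE inE; have := s0 x.
    by case: (leP 1 (s x)) => s1; rewrite ?mulr1n ?mulr0n; lra.
  rewrite trace big_split/= sumr_const card_ord -mulr_natl.
  have -> : \sum_x (x \in A)%:R / 2 = #|A|%:R / 2 :> R.
    by rewrite -mulr_suml -natr_sum -big_mkcond sum1_card.
  lra.
pose rho x y := \sum_i H i x * H i y / (Num.sqrt (s x) * Num.sqrt (s y)).
have sA x : x \in A -> 1 <= s x by rewrite inE.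
have row_rho x : x \in A -> \sum_(y in A) rho x y ^+ 2 <= 2 * k.
  move=> xA; have sx := sA _ xA.
  (* For [y] in [A], [1 / s y <= 2 / a y]. The sum weighted by [1 / a y] is then evaluated by
     expanding the square: isotropy leaves only the diagonal terms. *)
  apply: (@le_trans _ _ (2 / s x * \sum_y (\sum_i H i x * H i y) ^+ 2 / a y)).
    rewrite mulr_sumr [leRHS](bigID [in A])/= -[leLHS]addr0 lerD//; last first.
      apply: sumr_ge0 => y _; apply: mulr_ge0; first by rewrite divr_ge0.
      by rewrite divr_ge0 ?sqr_ge0// ltW.
    apply: ler_sum => y yA; have sy := sA _ yA.
    rewrite /rho -mulr_suml exprMn exprVn exprMn !sqr_sqrtr//.
    set X := (\sum_i _) ^+ 2.
    have X0 : 0 <= X / s x by rewrite divr_ge0// sqr_ge0.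
    rewrite (_ : 2 / s x * (X / a y) = X / s x * (2 / a y)); last by ring.
    rewrite invfM mulrA ler_wpM2l// ler_pdivlMr// mulrC ler_pdivrMr ?aE; lra.
  have -> : \sum_y (\sum_i H i x * H i y) ^+ 2 / a y = k * s x.
    transitivity (\sum_y \sum_i \sum_j H i x * H j x * (H i y * H j y / a y)).
      apply: eq_bigr => y _; rewrite expr2 mulr_suml mulr_suml.
      apply: eq_bigr => i _; rewrite mulr_sumr mulr_suml.
      by apply: eq_bigr => j _; ring.
    rewrite exchange_big mulr_sumr/=; apply: eq_bigr => i _.
    rewrite exchange_big (bigD1 i)//= [X in _ + X]big1 ?addr0 => [|j ji].
      by rewrite -mulr_sumr isoG eqxx mul1r -/k; ring.
    by rewrite -mulr_sumr isoG eq_sym (negbTE ji) !mul0r mulr0.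
  by rewrite [k * _]mulrC mulrA divfK// gt_eqF//; lra.
move=> Ed EdA.
pose Ed' := [set e in Ed | rho e.1 e.2 <= 1 / 24]%SET.
pose t := [seq row i G | i <- enum 'I_N].
pose f x := scaled_eval x (Num.sqrt (s x)).
have fE x i : f x (row i G) = H i x / Num.sqrt (s x).
  by rewrite /f /scaled_eval -row_mul mxE.
have sqrt0 x : x \in A -> 0 < Num.sqrt (s x).
  by move=> /sA sx; rewrite sqrtr_gt0; lra.
have f1 x : x \in A -> \sum_(c <- t) f x c ^+ 2 = 1.
  move=> xA; have sx := sA _ xA.
  rewrite big_map big_enum/=; under eq_bigr do rewrite fE exprMn exprVn sqr_sqrtr//.
  by rewrite -mulr_suml -/(s x) divff// gt_eqF//; lra.
have mean_Ed' : 1 / 648 * #|Ed'|%:R <= mean t (fun c =>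
    \sum_(e in Ed') (f e.1 c * f e.2 c < 0)%R%:R : R).
  rewrite (_ : mean _ _ = \sum_(e in Ed')
    mean t (fun c => (f e.1 c * f e.2 c < 0)%R%:R : R)); last exact: mean_sum.
  rewrite mulrC mulr_natl -sumr_const; apply: ler_sum => e.
  rewrite inE => /andP[/EdA[e1 e2] rhoe]; apply: mean_sign_change; [exact: f1 | exact: f1 |].
  rewrite big_map big_enum/= (le_trans _ rhoe)// le_eqVlt; apply/orP; left; apply/eqP.
  apply: eq_bigr => i _; transitivity (f e.1 (row i G) * f e.2 (row i G)) => //.
  by rewrite !fE invfM; ring.
have [c hc] := mean_le_exists mean_Ed'.
exists c.
have eD : #|Ed| = (#|Ed'| + #|(Ed :\: Ed')%SET|)%N.
  rewrite -(cardsID Ed' Ed) (finset.setIidPr _)//.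
  by apply/fintype.subsetP => e; rewrite inE => /andP[].
(* A discarded pair has correlation above 1/24, hence 576 times its square exceeds 1; the row sums
   then give 576 * 2k = 864 S/N per point of [A]. *)
have bad : #|Ed|%:R - #|Ed'|%:R <= 864 * S%:R / N%:R * #|A|%:R :> R.
  have -> : #|Ed|%:R - #|Ed'|%:R = #|(Ed :\: Ed')%SET|%:R :> R.
    by rewrite eD natrD; ring.
  apply: (@le_trans _ _ (\sum_(x in A) \sum_(y in A) 576 * rho x y ^+ 2)).
    rewrite pair_big/= (eq_bigl [in finset.setX A A]) => [|e]; last by rewrite !inE.
    rewrite -sum1_card natr_sum [leRHS](big_setID (Ed :\: Ed')%SET)/=.
    rewrite -[leLHS]addr0 lerD//; last first.
      by apply: sumr_ge0 => e _; rewrite mulr_ge0 ?sqr_ge0 ?ler0n.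
    rewrite (finset.setIidPr _); last first.
      by apply/fintype.subsetP => e; rewrite !inE => /andP[_ /EdA[]]; rewrite !inE => -> ->.
    apply: ler_sum => e; rewrite !inE => /andP[eE' eE]; move: eE'; rewrite eE -ltNge => r24.
    by nra.
  apply: (@le_trans _ _ (\sum_(x in A) 576 * (2 * k))).
    by apply: ler_sum => x xA; rewrite -mulr_sumr ler_pM2l ?ltr0n ?row_rho.
  rewrite sumr_const -mulr_natl /k !natrM le_eqVlt; apply/orP; left; apply/eqP.
  by field; lra.
apply: (@le_trans _ _ (1 / 648 * #|Ed'|%:R)); first lra.
apply: (le_trans hc); rewrite -natr_sum ler_nat -big_mkcondr/= sum1_card.
apply: subset_leq_card; apply/fintype.subsetP => e.
rewrite [_ \in (fun _ => _)]unfold_in !inE => /andP[/andP[eE _]].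
have [e1 e2] := EdA _ eE.
by rewrite eE /= /f /scaled_eval mulf_div pmulr_llt0// invr_gt0 mulr_gt0// sqrt0.
Qed.

End ManySignChanges.

(** * Consecutive points on a line and sign changes in one variable *)

Section ConsecutivePairs.
Context {R : realType}.

Lemma root_between (q : {poly R}) (a b : R) : a < b -> q.[a] * q.[b] < 0 ->
  exists2 r, a < r < b & root q r.
Proof.
move=> ab qab.
have qa : q.[a] != 0 by apply/eqP => q0; rewrite q0 mul0r ltxx in qab.
have qb : q.[b] != 0 by apply/eqP => q0; rewrite q0 mulr0 ltxx in qab.
have [r /andP[ar rb] qr] : exists2 r, a <= r <= b & root q r.
  have [q0|q0] := ltP q.[a] 0.
    apply: poly_ivt; first exact: ltW.
    by rewrite (ltW q0)/=; nra.
  have [||r rab] := @poly_ivt _ (- q) a b; first exact: ltW.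
    by rewrite !hornerN; nra.
  by rewrite rootN; exists r.
exists r => //; rewrite !lt_neqAle ar rb !andbT; apply/andP; split.
  by apply: contra qa => /eqP ->.
by apply: contra qb => /eqP <-.
Qed.

(** Each sign change gives a root strictly inside its gap, and the gaps are disjoint. The bound
    [tau x < r] carries this disjointness through the induction. *)
Lemma count_sign_changes (T : Type) (tau : T -> R) (q : {poly R}) x s :
  path (fun y z => tau y < tau z) x s ->
  exists rs : seq R, [/\ uniq rs, all (root q) rs, all (fun r => tau x < r) rs &
    size rs = count (fun e => q.[tau e.1] * q.[tau e.2] < 0) (zip (x :: s) s)].
Proof.
elim: s x => [|y s IH] x /=; first by exists [::].
move=> /andP[xy /IH[rs [urs rrs yrs szrs]]].
have xrs : all (fun r => tau x < r) rs.
  by apply: sub_all yrs => r /=; exact: lt_trans.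
case: ltP => qxy; last by exists rs.
have [r /andP[xr ry] qr] := root_between xy qxy.
exists (r :: rs); split => /=; rewrite ?urs ?qr ?xr ?szrs//.
rewrite andbT; apply/negP => /(allP yrs); by rewrite ltNge (ltW ry).
Qed.

(** Neighbours in the order of [tau] are paired: m points give m - 1 pairs, and none if [A] is
    empty. Sign changes are bounded by the number of roots; the zero polynomial has no strict sign
    change. *)
Lemma consecutive_pairs (T : finType) (tau : T -> R) (A : {set T}) :
  {in A &, injective tau} ->
  exists C : {set T * T}, [/\ (#|A| <= #|C|.+1)%N,
    forall e, e \in C -> [/\ e.1 \in A, e.2 \in A & tau e.1 < tau e.2] &
    forall q : {poly R},
      (#|[set e in C | (q.[tau e.1] * q.[tau e.2] < 0)%R]%SET| <= (size q).-1)%N].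
Proof.
move=> injtau; pose le y z := tau y <= tau z.
pose s := sort le (enum A).
have sA : s =i A by move=> y; rewrite mem_sort mem_enum.
have us : uniq s by rewrite sort_uniq enum_uniq.
have ss : sorted (fun y z => tau y < tau z) s.
  have : sorted le s by apply: sort_sorted => y z; exact: le_total.
  have sA' y : y \in s -> y \in A by rewrite sA.
  elim: (s) us sA' => // x [|y r] IH //= /andP[xyr uyr] sA' /andP[xy yr].
  rewrite lt_neqAle [_ <= _]xy andbT; apply/andP; split.
    apply: contra xyr => /eqP/injtau ->; rewrite ?mem_head//.
      by apply: sA'; rewrite mem_head.
    by apply: sA'; rewrite inE mem_head orbT.
  by apply: IH => // z zr; apply: sA'; rewrite inE zr orbT.
have cA : #|A| = size s by rewrite size_sort cardE.
case: s sA us ss cA => [|x s] sA us ss cA.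
  exists finset.set0; split => [|e|q]; rewrite ?inE// ?cA//.
  by rewrite (_ : [set _ in _ | _]%SET = finset.set0) ?cards0//; apply/setP => e; rewrite !inE.
have uz : uniq (zip (x :: s) s).
  apply: (@map_uniq _ _ snd); rewrite -/unzip2 unzip2_zip; first by case/andP: us.
  exact: leqnSn.
exists [set e in zip (x :: s) s]%SET; split.
- by rewrite cardsE (card_uniqP uz) size_zip cA /= minnE; lia.
- move=> e; rewrite inE => ez.
  have : all (fun e => [&& e.1 \in x :: s, e.2 \in x :: s & tau e.1 < tau e.2]) (zip (x :: s) s).
    elim: (s) (x) ss => //= z r IH y /andP[yz zr].
    rewrite !inE !eqxx orbT yz/=; apply: sub_all (IH _ zr) => f /and3P[f1 f2 ->].
    by rewrite !(inE, orbA) in f1 f2 *; rewrite -!orbA f1 f2 !orbT.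
  by move=> /allP/(_ e ez); rewrite -!sA => /and3P.
- move=> q; have [rs [urs rrs _ szrs]] := count_sign_changes q ss.
  pose P e := q.[tau e.1] * q.[tau e.2] < 0.
  rewrite (_ : [set _ in _ | _]%SET = [set e in seq.filter P (zip (x :: s) s)]%SET); last first.
    by apply/setP => e; rewrite !inE mem_filter andbC.
  rewrite cardsE (card_uniqP (filter_uniq _ uz)) size_filter -szrs.
  have [q0|q0] := eqVneq q 0; last first.
    by rewrite -ltnS prednK ?size_poly_gt0//; exact: max_poly_roots.
  rewrite szrs q0; rewrite (eq_count (a2 := pred0)) ?count_pred0// => e.
  by rewrite !horner0 mul0r ltxx.
Qed.

End ConsecutivePairs.

(** * Polynomial functions and their gradients *)

Section PolynomialFunctions.
Context {R : realType} {n : nat}.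
Implicit Types (f : 'rV[R]_n -> R) (p v x : 'rV[R]_n).

(** The index bounds the degree. Generating by constants, sums and products with one coordinate
    allows the gradient to be built by induction. *)
Inductive polyfun : nat -> ('rV[R]_n -> R) -> Prop :=
| polyfun_cst c : polyfun 0 (fun=> c)
| polyfun_weaken d f : polyfun d f -> polyfun d.+1 f
| polyfunD d f g : polyfun d f -> polyfun d g -> polyfun d (fun x => f x + g x)
| polyfun_coord d i f : polyfun d f -> polyfun d.+1 (fun x => x ord0 i * f x).

Lemma polyfun_le d d' f : (d <= d')%N -> polyfun d f -> polyfun d' f.
Proof.
move=> /subnK <-; elim: (d' - d)%N => // m IH pf.
by rewrite addSn; apply: polyfun_weaken; exact: IH.
Qed.

Lemma polyfun_const d (c : R) : polyfun d (fun=> c).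
Proof. exact: polyfun_le (polyfun_cst c). Qed.

Lemma polyfunZ d (c : R) f : polyfun d f -> polyfun d (fun x => c * f x).
Proof.
elim=> [b|e g _ IH|e g h _ IHg _ IHh|e i g _ IH].
- exact: polyfun_cst.
- exact: polyfun_weaken.
- rewrite (_ : (fun x => _) = (fun x => c * g x + c * h x)); first exact: polyfunD.
  by apply/funext => x; rewrite mulrDr.
- rewrite (_ : (fun x => _) = (fun x => x ord0 i * (c * g x))); first exact: polyfun_coord.
  by apply/funext => x; rewrite mulrCA.
Qed.

Lemma polyfun_sum d (I : Type) (r : seq I) (F : I -> 'rV[R]_n -> R) :
  (forall i, polyfun d (F i)) -> polyfun d (fun x => \sum_(i <- r) F i x).
Proof.
move=> pF; elim: r => [|i r IH].
  rewrite (_ : (fun x => _) = (fun=> 0)); first exact: polyfun_const.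
  by apply/funext => x; rewrite big_nil.
rewrite (_ : (fun x => _) = (fun x => F i x + \sum_(j <- r) F j x)).
  by apply: polyfunD => //.
by apply/funext => x; rewrite big_cons.
Qed.

Lemma polyfun_coordX d i e f : polyfun d f -> polyfun (e + d) (fun x => x ord0 i ^+ e * f x).
Proof.
move=> pf; elim: e => [|e IH].
  rewrite (_ : (fun x => _) = f) //; by apply/funext => x; rewrite mul1r.
rewrite addSn (_ : (fun x => _) = (fun x => x ord0 i * (x ord0 i ^+ e * f x))).
  exact: polyfun_coord.
by apply/funext => x; rewrite exprS mulrA.
Qed.

Lemma polyfun_monomial (D : nat) (r : seq 'I_n) (a : 'I_n -> nat) : (forall i, a i <= D)%N ->
  polyfun (size r * D) (fun x => \prod_(i <- r) x ord0 i ^+ a i).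
Proof.
move=> aD; elim: r => [|i r IH].
  rewrite (_ : (fun x => _) = (fun=> 1)); first exact: polyfun_const.
  by apply/funext => x; rewrite big_nil.
rewrite (_ : (fun x => _) = (fun x => x ord0 i ^+ a i * \prod_(i <- r) x ord0 i ^+ a i)).
  apply: (@polyfun_le (a i + size r * D)); last exact: polyfun_coordX.
  by rewrite mulSn leq_add2r.
by apply/funext => x; rewrite big_cons.
Qed.

(** The gradient is linked to [f] only through restrictions to lines, where one-variable derivatives
    suffice. The clause for degree 0 compensates for [0.-1 = 0] in the product rule. *)
Lemma polyfun_gradient d f : polyfun d f ->
  exists g : 'I_n -> 'rV[R]_n -> R,
  [/\ forall i, polyfun d.-1 (g i), d = 0%N -> forall i x, g i x = 0 &
    forall p v, exists q : {poly R}, [/\ (size q <= d.+1)%N,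
      forall t, q.[t] = f (p + t *: v) &
      forall t, q^`().[t] = \sum_i v ord0 i * g i (p + t *: v)]].
Proof.
elim=> {d f} [c|d f pf [g [pg g0 gq]]
  |d f h pf [gf [pgf gf0 qf]] ph [gh [pgh gh0 qh]]|d i f pf [g [pg g0 gq]]].
- exists (fun _ => fun=> 0); split => // [_|p v]; first exact: polyfun_cst.
  exists c%:P; split => [|t|t]; first exact: size_polyC_leq1.
    by rewrite hornerC.
  by rewrite derivC horner0 big1// => i _; rewrite mulr0.
- exists g; split => // [i /=|p v].
    by apply: polyfun_le (pg i); exact: leq_pred.
  by have [q [sq qE q'E]] := gq p v; exists q; split => //; exact: leqW.
- exists (fun i x => gf i x + gh i x); split => [i|d0 i x|p v].
  + exact: polyfunD.
  + by rewrite gf0// gh0// addr0.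
  have [q [sq qE q'E]] := qf p v; have [r [sr rE r'E]] := qh p v.
  exists (q + r); split => [|t|t].
  + by rewrite (leq_trans (size_polyD _ _))// geq_max sq.
  + by rewrite hornerD qE rE.
  + by rewrite derivD hornerD q'E r'E -big_split; apply: eq_bigr => i _; rewrite mulrDr.
- exists (fun j x => (i == j)%:R * f x + x ord0 i * g j x); split => // [j /=|p v].
    apply: polyfunD; first exact: polyfunZ.
    case: d pf pg g0 {gq} => [|d] pf pg g0; last exact: polyfun_coord.
    rewrite (_ : (fun x => _) = (fun=> 0)); first exact: polyfun_const.
    by apply/funext => x; rewrite g0 ?mulr0.
  have [q [sq qE q'E]] := gq p v.
  exists (((p ord0 i)%:P + (v ord0 i) *: 'X) * q); split => [|t|t].
  + have s2 : (size ((p ord0 i)%:P + (v ord0 i) *: 'X)%R <= 2)%N.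
      rewrite (leq_trans (size_polyD _ _))// geq_max (leq_trans (size_polyC_leq1 _))//=.
      by rewrite (leq_trans (size_scale_leq _ _))// size_polyX.
    by have := size_polyMleq ((p ord0 i)%:P + (v ord0 i) *: 'X) q; lia.
  + by rewrite hornerM hornerD hornerC hornerZ hornerX qE !mxE [t * _]mulrC.
  + rewrite derivM hornerD !hornerM !derivD derivC add0r derivZ derivX !hornerD hornerC !hornerZ.
    rewrite hornerX hornerC mulr1 qE q'E.
    under [in RHS]eq_bigr do rewrite mulrDr.
    rewrite big_split/=; congr (_ + _).
      rewrite (bigD1 i)//= eqxx mul1r big1 ?addr0// => j ji.
      by rewrite eq_sym (negbTE ji) mul0r mulr0.
    rewrite mulr_sumr; apply: eq_bigr => j _; rewrite !mxE; ring.
Qed.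

End PolynomialFunctions.

(** * Polynomials vanishing at points that are rich on every line *)

Lemma horner_eq0 {R : realType} (q : {poly R}) : (forall t, q.[t] = 0) -> q = 0.
Proof.
move=> q0; apply/eqP; apply: contraT => qn0.
have := @max_poly_roots _ q [seq i%:R | i <- iota 0 (size q)] qn0.
rewrite size_map size_iota ltnn => h; apply: h.
  by apply/allP => t _; rewrite /root q0.
by rewrite map_inj_uniq ?iota_uniq// => i j /eqP; rewrite eqr_nat => /eqP.
Qed.

Section Vanishing.
Context {R : realType} {n S : nat} (pt : 'I_S -> 'rV[R]_n).
Hypothesis pt_inj : injective pt.
Implicit Types (M LL : {fset set 'rV[R]_n}) (Q : {set 'I_S}).

Definition on_line Q (l : set 'rV[R]_n) : {set 'I_S} := [set x in Q | pt x \in l]%SET.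

Lemma lineP (l : set 'rV[R]_n) v x : direction l v -> x \in l ->
  v != 0 /\ l = line x v.
Proof.
move=> [v0 [p lp]] xl; split => //; move: xl; rewrite lp inE => -[t _ <-].
apply/seteqP; split=> y [s _ <-].
  by exists (s - t) => //; rewrite -addrA -scalerDl; congr (_ + _ *: _); ring.
by exists (t + s) => //; rewrite scalerDl addrA.
Qed.

Lemma line_param p v : v != 0 ->
  exists tau : 'rV[R]_n -> R, forall y, y \in line p v -> y = p + tau y *: v.
Proof.
move=> /rV0Pn[i vi].
exists (fun y => (y ord0 i - p ord0 i) / v ord0 i) => y; rewrite inE => -[t _ <-].
by congr (_ + _ *: _); rewrite !mxE; field.
Qed.

Lemma span_functional_eq0 (vs : seq 'rV[R]_n) (g : 'I_n -> R) : <<vs>>%VS = fullv ->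
  (forall v, v \in vs -> \sum_i v ord0 i * g i = 0) -> forall i, g i = 0.
Proof.
move=> span vs0 i; pose gc := \col_j g j.
have vgc (v : 'rV[R]_n) : (v *m gc) ord0 ord0 = \sum_j v ord0 j * g j.
  by rewrite mxE; apply: eq_bigr => j _; rewrite mxE.
have := vgc (delta_mx 0 i); rewrite -rowE !mxE => gE; rewrite gE -vgc.
have /coord_span -> : delta_mx 0 i \in <<in_tuple vs>>%VS by rewrite span memvf.
rewrite mulmx_suml summxE big1// => j _; rewrite -scalemxAl mxE vgc vs0 ?mulr0//.
by apply: mem_nth; rewrite [X in (_ < X)%N](_ : _ = size (in_tuple vs)) ?size_tuple.
Qed.

(* The polynomial vanishes on every line of [M], so its gradient vanishes on [Q];
   the gradient is zero by induction on the degree. *)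
Lemma polyfun_eq0 M Q d :
  Q != finset.set0 -> (forall l, l \in M -> (d < #|on_line Q l|)%N) ->
  (forall x, x \in Q -> exists2 vs : seq 'rV[R]_n, <<vs>>%VS = fullv &
     forall v, v \in vs -> exists l, [/\ l \in M, pt x \in l & direction l v]) ->
  forall e f, (e <= d)%N -> polyfun e f -> (forall x, x \in Q -> f (pt x) = 0) ->
  forall y, f y = 0.
Proof.
move=> /set0Pn[x0 x0Q] rich span.
have grad_eq0 e f g : (e <= d)%N -> (forall x, x \in Q -> f (pt x) = 0) ->
    (forall p v, exists q : {poly R}, [/\ (size q <= e.+1)%N,
      forall t, q.[t] = f (p + t *: v) &
      forall t, q^`().[t] = \sum_i v ord0 i * g i (p + t *: v)]) ->
    forall x, x \in Q -> forall i, g i (pt x) = 0.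
  move=> ed f0 gq x xQ; have [vs spanvs dirvs] := span _ xQ.
  apply: (span_functional_eq0 (g := fun i => g i (pt x)) spanvs) => v /dirvs[l [lM xl dlv]].
  have [v0 lE] := lineP dlv xl.
  have [tau tauE] := line_param (pt x) v0; rewrite -lE in tauE.
  have [q [sq qE q'E]] := gq (pt x) v.
  suff q0 : q = 0.
    by have := q'E 0; rewrite q0 derivC horner0 scale0r addr0.
  apply: contraTeq (rich _ lM) => q0; rewrite -leqNgt.
  have := @max_poly_roots _ q [seq tau (pt z) | z <- enum (on_line Q l)] q0.
  rewrite size_map -cardE => h; suff : (#|on_line Q l| < size q)%N by move: sq ed; clear; lia.
  apply: h.
    apply/allP => _ /mapP[z zl ->]; rewrite /root qE.
    by move: zl; rewrite mem_enum inE => /andP[zQ /tauE <-]; rewrite f0.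
  rewrite map_inj_in_uniq ?enum_uniq// => y z; rewrite !mem_enum !inE.
  move=> /andP[_ /tauE yE] /andP[_ /tauE zE] tauyz.
  by apply: pt_inj; rewrite yE zE tauyz.
(* With zero gradient, [f] is constant along the line from [pt x0] to [y], and [f (pt x0) = 0]. *)
have const e f g : (forall x, x \in Q -> f (pt x) = 0) ->
    (forall p v, exists q : {poly R}, [/\ (size q <= e.+1)%N,
      forall t, q.[t] = f (p + t *: v) &
      forall t, q^`().[t] = \sum_i v ord0 i * g i (p + t *: v)]) ->
    (forall i z, g i z = 0) -> forall y, f y = 0.
  move=> f0 gq g0 y; have [q [_ qE q'E]] := gq (pt x0) (y - pt x0).
  have q'0 : q^`() = 0.
    by apply: horner_eq0 => t; rewrite q'E big1// => i _; rewrite g0 mulr0.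
  have q1 := qE 1; have := qE 0; rewrite scale0r addr0 f0//.
  rewrite scale1r addrC subrK in q1; rewrite -q1.
  have : (size q <= 1)%N.
    apply/leq_sizeP => -[//|i] _; have := coef_deriv q i; rewrite q'0 coef0.
    by move=> /esym/eqP; rewrite mulrn_eq0 => /eqP.
  by move=> /size1_polyC ->; rewrite !hornerC.
elim=> [|e IH] f ed pf f0.
  by have [g [_ g0 gq]] := polyfun_gradient pf; apply: (const _ _ _ f0 gq); exact: g0.
have [g [pg _ gq]] := polyfun_gradient pf; apply: (const _ _ _ f0 gq) => i.
by apply: (IH (g i) (ltnW ed) (pg i)) => x xQ; exact: (grad_eq0 _ _ _ ed f0 gq).
Qed.

(* Deleting a line with at most [d] points of [Q'] decreases the sum by at most [d]. *)
Lemma prune LL Q d : (d * #|` LL| < \sum_(x in Q) (#|` lines_through LL (pt x)| - n.-1))%N ->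
  exists2 M, (M `<=` LL)%fset &
    let Q' := [set x in Q | (n.-1 < #|` lines_through M (pt x)|)%N]%SET in
    Q' != finset.set0 /\ forall l, l \in M -> (d < #|on_line Q' l|)%N.
Proof.
move: {2}#|` LL| (erefl #|` LL|) => m; elim: m LL => [|m IH] LL cLL h.
all: pose Q' := [set x in Q | (n.-1 < #|` lines_through LL (pt x)|)%N]%SET.
all: have Q'0 : Q' != finset.set0.
1,3: apply: contraTneq h => Q'0; rewrite -leqNgt big1// => x xQ; apply/eqP.
1,2: by rewrite subn_eq0 leqNgt; apply/negP => xlt; move/setP/(_ x) : Q'0; rewrite !inE xQ xlt.
  exists LL => //; split => // l; by rewrite (cardfs0_eq cLL) inE.
have [rich|] := pselect (forall l, l \in LL -> (d < #|on_line Q' l|)%N); first by exists LL.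
move=> /existsNP[l /not_implyP[lLL /negP]]; rewrite -leqNgt => poor.
have cLL' : #|` LL `\ l|%fset = m by have := cardfsD1 l LL; rewrite lLL cLL => -[].
have lt x : #|` lines_through LL (pt x)| =
    ((pt x \in l) + #|` lines_through (LL `\ l)%fset (pt x)|)%N.
  have <- : (lines_through LL (pt x) `\ l = lines_through (LL `\ l) (pt x))%fset.
    by apply/fsetP => z; rewrite !inE/=; case: (z == l).
  by rewrite (cardfsD1 l (lines_through LL (pt x))) !inE lLL.
have [|M ML hM] := IH _ cLL'; last by exists M => //; apply: (fsubset_trans ML); exact: fsubD1set.
(* Points on at most [n.-1] lines already contribute 0 to the truncated sum, so deleting [l] costs
   at most 1 for each point of [Q'] on it. *)
have step : (\sum_(x in Q) (#|` lines_through LL (pt x)| - n.-1) <=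
   \sum_(x in Q) (#|` lines_through (LL `\ l)%fset (pt x)| - n.-1) + #|on_line Q' l|)%N.
  rewrite -sum1_card [X in (_ + X)%N](_ : _ = (\sum_(x in Q) (x \in on_line Q' l))%N); last first.
    by rewrite -big_mkcondr; apply: eq_bigl => x; rewrite !inE; case: (x \in Q).
  rewrite -big_split/=; apply: leq_sum => x xQ; rewrite !inE xQ/= lt.
  by case: (pt x \in l) => /=; lia.
by rewrite cLL' ; rewrite cLL in h; lia.
Qed.

End Vanishing.

(** * A free family of monomials *)

Section Monomials.
Context {R : realType} {n : nat} (D : nat).

(** Digits in base D + 1 enumerate the exponent vectors with entries at most [D], so the numbers
    below (D+1)^n index monomials of degree at most nD. *)
Definition digit (i j : nat) : nat := (j %/ D.+1 ^ i %% D.+1)%N.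

Definition monomial (j : nat) (x : 'rV[R]_n) : R := \prod_(i < n) x ord0 i ^+ digit i j.

Lemma digit_expansion m j : (\sum_(i < m) D.+1 ^ i * digit i j = j %% D.+1 ^ m)%N.
Proof.
elim: m => [|m IH]; first by rewrite big_ord0 modn1.
rewrite big_ord_recr/= IH /digit expnSr; set b := (D.+1 ^ m)%N.
have b0 : (0 < b)%N by rewrite expn_gt0.
rewrite [in RHS](divn_eq j b) {2}(divn_eq (j %/ b) D.+1) mulnDl -addnA -mulnA.
rewrite [(D.+1 * b)%N]mulnC modnMDl [RHS]modn_small; first by rewrite addnC mulnC.
have := ltn_pmod j b0; have := @ltn_pmod (j %/ b) D.+1 isT; nia.
Qed.

Lemma polyfun_combination N (c : 'rV[R]_N) :
  polyfun (n * D) (fun x => \sum_j c ord0 j * monomial j x).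
Proof.
apply: polyfun_sum => j; apply: polyfunZ.
rewrite (_ : monomial j = fun x => \prod_(i <- enum 'I_n) x ord0 i ^+ digit i j).
  have := @polyfun_monomial R n D (enum 'I_n) (digit^~ j); rewrite size_enum_ord; apply => i.
  by rewrite -ltnS ltn_pmod.
by apply/funext => x; rewrite big_enum.
Qed.

(* Substituting [x_i = t^((D+1)^i)] turns the j-th monomial into [t^j]. *)
Lemma monomials_free (c : 'rV[R]_(D.+1 ^ n)) : c != 0 ->
  exists y, \sum_j c ord0 j * monomial j y != 0.
Proof.
move=> c0; apply/not_existsP => all0; move/negP: c0; apply; apply/eqP.
rewrite -[c]rVpolyK (_ : rVpoly c = 0) ?linear0//; apply: horner_eq0 => t.
have /negP := all0 (\row_i t ^+ (D.+1 ^ i)); rewrite negbK => /eqP <-.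
rewrite (@horner_coef_wide _ (D.+1 ^ n)) ?size_poly//; apply: eq_bigr => j _.
rewrite coef_rVpoly_ord; congr (_ * _).
rewrite /monomial; under eq_bigr do rewrite mxE -exprM.
by rewrite -expr_sum digit_expansion modn_small.
Qed.

End Monomials.

(** * Counting generic joints at a fixed degree *)

Lemma line_unique {R : realType} {n} (l l' : set 'rV[R]_n) y z : is_line l -> is_line l' ->
  y != z -> y \in l -> z \in l -> y \in l' -> z \in l' -> l = l'.
Proof.
suff lineE m : is_line m -> y != z -> y \in m -> z \in m -> m = line y (z - y).
  by move=> ll ll' yz yl zl yl' zl'; rewrite (lineE l)// (lineE l').
move=> [v dv] yz ym zm; have [v0 mE] := lineP dv ym.
move: zm yz; rewrite mE inE => -[t _ <-] yz; rewrite addrAC subrr add0r.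
have t0 : t != 0.
  by apply: contraNneq yz => ->; rewrite scale0r addr0.
apply/seteqP; split => _ [s _ <-].
  by exists (s / t) => //; rewrite scalerA divfK.
by exists (s * t) => //; rewrite scalerA.
Qed.

Section GenericJoints.
Context {R : realType} {n S : nat} (pt : 'I_S -> 'rV[R]_n).
Hypotheses (n_gt0 : (0 < n)%N) (pt_inj : injective pt).
Variables (LL : {fset set 'rV[R]_n}) (k : nat).
Hypotheses (nk : (n <= k)%N) (rich : forall x, (k <= #|` lines_through LL (pt x)|)%N).

(** Otherwise n (m - n + 1) >= m for m >= n yields the hypothesis of [prune]. At a surviving point,
    [n] of the surviving lines span by genericity, so [polyfun_eq0] makes [f] zero. *)
Lemma card_zeros_generic_joints (Q : {set 'I_S}) d f :
  (forall x, x \in Q -> generic_joint LL (pt x)) ->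
  polyfun d f -> (exists y, f y != 0) -> (forall x, x \in Q -> f (pt x) = 0) ->
  (#|Q| * k <= n * (d * #|` LL|))%N.
Proof.
move=> gen pf [y fy] f0; rewrite leqNgt; apply/negP => lt.
have lt' : (d * #|` LL| < \sum_(x in Q) (#|` lines_through LL (pt x)| - n.-1))%N.
  rewrite -(ltn_pmul2l n_gt0); apply: (leq_trans lt).
  rewrite -sum_nat_const big_distrr/=; apply: leq_sum => x xQ.
  have := rich x; set m := #|` _| => km.
  have -> : (m - n.-1 = (m - n).+1)%N by lia.
  by rewrite mulnS; have := leq_pmull (m - n) n_gt0; lia.
have [M ML [Q'0 richM]] := prune lt'.
move/negP: fy; apply; apply/eqP; apply: (polyfun_eq0 pt_inj Q'0 richM _ (leqnn d) pf) => x.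
all: rewrite inE => /andP[xQ nx].
  pose T := lines_through M (pt x); pose T' := [fset l in take n T]%fset.
  have T'T : (T' `<=` T)%fset by apply/fsubsetP => l; rewrite inE => /mem_take.
  have cT' : #|` T'| = n.
    rewrite card_fseq undup_id ?take_uniq ?fset_uniq// size_take_min; apply/minn_idPl.
    by move: nx; rewrite prednK.
  have [|vs [vsT' vsfull]] := gen _ xQ T' _ cT'.
    apply: (fsubset_trans T'T); apply/fsubsetP => l; rewrite !inE/= => /andP[lM ->].
    by rewrite (fsubsetP ML).
  exists vs => // v /vsT'[l /(fsubsetP T'T)]; rewrite !inE/= => /andP[lM xl] dl.
  by exists l.
exact: f0.
Qed.

(** The first inequality limits the zeros of a nonzero combination to S/8 points; the second gives
    864 S/N <= k/2. With L lines and at least k|A| - L pairs, some polynomial has at least (k|A|/2 -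
    L)/648 sign changes, but at most nD per line; finally S <= 2|A|. *)
Lemma card_generic_joints D :
  (0 < S)%N -> (forall l, l \in LL -> is_line l) ->
  (forall x, generic_joint LL (pt x)) ->
  (8 * n ^ 2 * D * #|` LL| <= S * k)%N -> (1728 * S <= k * D.+1 ^ n)%N ->
  (k * S <= 4 * #|` LL| * (1 + 648 * (n * D)))%N.
Proof.
move=> S0 lines gen small large.
pose N := (D.+1 ^ n)%N; pose E : 'M[R]_(N, S) := \matrix_(j, x) monomial D j (pt x).
pose f (c : 'rV[R]_N) (y : 'rV[R]_n) := \sum_j c ord0 j * monomial D j y.
have pf (c : 'rV[R]_N) : polyfun (n * D) (f c) by exact: polyfun_combination.
have fE (c : 'rV[R]_N) x : (c *m E) ord0 x = f c (pt x).
  by rewrite mxE; apply: eq_bigr => j _; rewrite mxE.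
have N0 : (0 < N)%N by rewrite expn_gt0.
have zeros (c : 'rV[R]_N) : c != 0 -> (8 * #|[pred x | ((c *m E) ord0 x == 0)%R]| <= S)%N.
  move=> /monomials_free fc; rewrite -cardsE; set Q := [set _ in _]%SET.
  have k0 : (0 < k)%N by exact: leq_trans nk.
  have : (#|Q| * k <= n * (n * D * #|` LL|))%N.
    by apply: (card_zeros_generic_joints _ (pf c) fc) => // x; rewrite !inE fE => /eqP.
  by rewrite -(leq_pmul2r k0); nia.
have [A SA manyA] := many_sign_changes zeros S0 N0.
have tau_ (l : LL) : exists tau : 'rV[R]_n -> R,
    (forall q, polyfun (n * D) q -> exists2 r : {poly R}, (size r <= (n * D).+1)%N &
      forall y, y \in val l -> r.[tau y] = q y) /\
    {in val l &, injective tau}.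
  have [v [v0 [p lE]]] := lines _ (valP l).
  have [tau tauE] := line_param p v0; rewrite -lE in tauE.
  exists tau; split=> [q /polyfun_gradient[g [_ _ /(_ p v)[r [sr rE _]]]]|y z yl zl tyz].
    by exists r => // y yl; rewrite rE -tauE.
  by rewrite (tauE _ yl) (tauE _ zl) tyz.
have [tau tauP] := choice tau_.
have C_ (l : LL) : exists C : {set 'I_S * 'I_S}, [/\ (#|on_line pt A (val l)| <= #|C|.+1)%N,
    forall e, e \in C ->
      [/\ e.1 \in on_line pt A (val l), e.2 \in on_line pt A (val l) & e.1 != e.2] &
    forall c : 'rV[R]_N,
      (#|[set e in C | ((c *m E) ord0 e.1 * (c *m E) ord0 e.2 < 0)%R]%SET| <= n * D)%N].
  have [tauq tauinj] := tauP l.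
  have [|C [cC CA Cq]] := @consecutive_pairs R _ (fun x => tau l (pt x)) (on_line pt A (val l)).
    by move=> x y; rewrite !inE => /andP[_ xl] /andP[_ yl] /(tauinj _ _ xl yl)/pt_inj.
  exists C; split => // [e /CA[e1 e2 lt]|c].
    by split => //; apply: contraTneq lt => ->; rewrite ltxx.
  have [r sr rE] := tauq _ (pf c).
  have onl e : e \in C ->
      r.[tau l (pt e.1)] = (c *m E) ord0 e.1 /\ r.[tau l (pt e.2)] = (c *m E) ord0 e.2.
    by move=> /CA[]; rewrite !inE !fE => /andP[_ /rE ->] /andP[_ /rE ->].
  apply: leq_trans (_ : (size r).-1 <= _)%N; last by lia.
  apply: leq_trans (Cq r); apply: subset_leq_card; apply/fintype.subsetP => e.
  by rewrite !inE => /andP[eC]; have [-> ->] := onl e eC; rewrite eC.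
have [C CP] := choice C_.
(* A pair consists of two distinct points, which determine the line. *)
have disj (l l' : LL) : l != l' -> [disjoint C l & C l']%B.
  move=> ll'; apply/pred0P => e /=; apply/negP => /andP[el el'].
  have [_ /(_ _ el)[]] := CP l; have [_ /(_ _ el')[]] := CP l'.
  rewrite !inE => /andP[_ e1l'] /andP[_ e2l'] _ _ /andP[_ e1l] /andP[_ e2l] e12 _.
  have pt12 : pt e.1 != pt e.2 by apply: contraNneq e12 => /pt_inj ->.
  move/negP: ll'; apply; apply/eqP/val_inj.
  exact: (line_unique (lines _ (valP l)) (lines _ (valP l')) pt12 e1l e2l e1l' e2l').
pose Ed := (\bigcup_l C l)%SET.
have cEd (P : pred ('I_S * 'I_S)) :
    #|[set e in Ed | P e]%SET| = (\sum_l #|[set e in C l | P e]%SET|)%N.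
  rewrite -sum1_card [LHS](eq_bigl (fun e => (e \in Ed) && P e)) => [|e]; last by rewrite inE.
  rewrite [LHS]big_mkcondr/= partition_disjoint_bigcup//.
  apply: eq_bigr => l _; rewrite -big_mkcondr -sum1_card; apply: eq_bigl => e; by rewrite inE.
have EdA e : e \in Ed -> e.1 \in A /\ e.2 \in A.
  move=> /bigcupP[l _ el]; have [_ /(_ _ el)[]] := CP l.
  by rewrite !inE => /andP[-> _] /andP[-> _].
have [c hc] := manyA Ed EdA.
pose changes := [set e in Ed | ((c *m E) ord0 e.1 * (c *m E) ord0 e.2 < 0)%R]%SET.
have up : (#|changes| <= #|` LL| * (n * D))%N.
  rewrite cEd cardfE -sum_nat_const; apply: leq_sum => l _.
  by have [_ _] := CP l; exact.
(* Incidences between [A] and the lines are counted twice: each point lies on at least [k] lines,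
   and each line has at most one point more than pairs. *)
have low : (k * #|A| <= #|Ed| + #|` LL|)%N.
  have -> : #|Ed| = (\sum_l #|C l|)%N.
    have := cEd xpredT; rewrite (_ : [set _ in _ | _]%SET = Ed); last first.
      by apply/setP => e; rewrite inE andbT.
    move=> ->; apply: eq_bigr => l _; apply: eq_card => e; by rewrite inE andbT.
  have -> : #|` LL| = (\sum_(l : LL) 1)%N by rewrite sum1_card cardfE.
  rewrite -big_split/=.
  apply: (@leq_trans (\sum_(l : LL) #|on_line pt A (val l)|)); last first.
    by apply: leq_sum => l _; have [+ _ _] := CP l; rewrite addn1.
  under eq_bigr do rewrite -sum1_card big_mkcond/=.
  rewrite exchange_big/= mulnC -sum_nat_const.
  rewrite [leqRHS](bigID [in A])/= -[leqLHS]addn0 leq_add//; apply: leq_sum => x xA.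
  apply: (leq_trans (rich x)).
  rewrite -big_mkcond/= sum1_card.
  have sub : {subset lines_through LL (pt x) <=
      [seq val l | l <- enum [pred l : LL | pt x \in val l]]}.
    move=> l; rewrite !inE/= => /andP[lLL xl].
    by apply/mapP; exists [` lLL]%fset; rewrite ?mem_enum.
  apply: (leq_trans (uniq_leq_size (fset_uniq _) sub)).
  rewrite size_map -cardE; apply: subset_leq_card; apply/fintype.subsetP => l.
  move=> xl; have : x \in on_line pt A (val l) by rewrite inE xA; exact: xl.
  by [].
have N0' : 0 < N%:R :> R by rewrite ltr0n.
have up' : #|changes|%:R <= (#|` LL| * (n * D))%:R :> R.
  by rewrite ler_nat.
have low' : (k * #|A|)%:R <= (#|Ed| + #|` LL|)%:R :> R by rewrite ler_nat.
have large' : (1728 * S)%:R <= (k * N)%:R :> R by rewrite ler_nat.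
have SA' : S%:R <= (2 * #|A|)%:R :> R by rewrite ler_nat.
rewrite !natrM natrD in up' low' large' SA'.
have k2 : 864 * S%:R / N%:R <= k%:R / 2 :> R.
  by rewrite ler_pdivrMr//; lra.
have := ler_wpM2r (ler0n R #|A|) k2 => k2A.
rewrite -(ler_nat R) !(natrM, natrD).
have := ler_wpM2l (ler0n R k) SA'.
have := le_trans hc up'.
lra.
Qed.

End GenericJoints.

(** * Choice of the degree and the final bound *)

Lemma leq_mul_sqr (p q m L D : nat) : (0 < m)%N -> (0 < D)%N ->
  (p * L * (1 + q * (m * D)) <= p * q.+1 * m ^ 2 * L * D)%N.
Proof.
move=> m0 D0.
have h : (1 + q * (m * D) <= q.+1 * (m ^ 2 * D))%N.
  rewrite mulSn leq_add ?muln_gt0 ?expn_gt0 ?m0//.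
  by rewrite leq_mul// leq_mul// -[leqLHS]expn1 leq_pexp2l.
apply: leq_trans (_ : (p * L * (q.+1 * (m ^ 2 * D)) <= _)%N); first by rewrite leq_mul.
by rewrite mulnACA [(L * _)%N]mulnCA !mulnA.
Qed.

(** In the application [n.+1] is the dimension. Raising the second bound to this power and inserting
    the first eliminates [D]; one factor [S] cancels. *)
Lemma threshold_arith (a c n k S L D : nat) : (0 < S)%N -> (k * D ^ n.+1 <= a * S)%N ->
  (k * S <= c * L * D)%N -> (k ^ n.+2 * S ^ n <= a * c ^ n.+1 * L ^ n.+1)%N.
Proof.
move=> S0 kD kS; rewrite -(leq_pmul2r S0).
have h : ((k * S) ^ n.+1 <= (c * L * D) ^ n.+1)%N by rewrite leq_exp2r.
rewrite !expnMn in h.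
have -> : (k ^ n.+2 * S ^ n * S = k * (k ^ n.+1 * S ^ n.+1))%N.
  by rewrite (expnS k n.+1) (expnSr S) !mulnA.
have -> : (a * c ^ n.+1 * L ^ n.+1 * S = c ^ n.+1 * L ^ n.+1 * (a * S))%N by ring.
apply: leq_trans (_ : (c ^ n.+1 * L ^ n.+1 * (k * D ^ n.+1) <= _)%N); last by rewrite leq_mul.
by rewrite [leqRHS]mulnCA leq_mul.
Qed.

(** [D] is least with 1728 S <= k (D+1)^dim, so k D^dim <= 1728 S if D > 0. Either the degree is
    small enough for [card_generic_joints], or the failure of that condition itself bounds k S by a
    multiple of L D. If D = 0, the former case gives the linear alternative and the latter is
    impossible. *)
Lemma card_generic_joints_fset {R : realType} {n : nat} (LL : {fset set 'rV[R]_n.+2}) k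
    (P : {fset 'rV[R]_n.+2}) :
  (forall l, l \in LL -> is_line l) -> (n.+2 <= k)%N -> (forall x, x \in P -> Jk LL k x) ->
  (k * #|` P| <= 4 * #|` LL|)%N \/
  (k ^ n.+3 * #|` P| ^ n.+1 <= 1728 * (4 * 649 * n.+2 ^ 2) ^ n.+2 * #|` LL| ^ n.+2)%N.
Proof.
move=> lines nk PJ; set S := #|` P|; set L := #|` LL|.
have [->|S0] := posnP S; first by left; rewrite muln0.
have k0 : (0 < k)%N by exact: leq_trans nk.
pose pt (i : 'I_S) := nth 0 P i.
have ptP i : pt i \in P by exact: mem_nth.
have pt_inj : injective pt.
  by move=> i j /eqP; rewrite nth_uniq ?fset_uniq// => /eqP/val_inj.
have rich i : (k <= #|` lines_through LL (pt i)|)%N by have [_ /andP[]] := PJ _ (ptP i).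
have gen i : generic_joint LL (pt i) by have [] := PJ _ (ptP i).
have := @card_generic_joints R n.+2 S pt isT pt_inj LL k nk rich.
move: 1728%N => a core; set c := (4 * 649 * n.+2 ^ 2)%N.
have exD : exists D, (a * S <= k * D.+1 ^ n.+2)%N.
  exists (a * S)%N; apply: (@leq_trans (a * S).+1 _ _ (leqnSn _)).
  by rewrite -[leqLHS]mul1n leq_mul// -[leqLHS]expn1 leq_pexp2l.
case: (ex_minnP exD) => D large minD {exD}.
have [small|/ltnW big] := leqP (8 * n.+2 ^ 2 * D * #|` LL|) (S * k).
  have := core D S0 lines gen small large; rewrite -/L => kS.
  case: D small large minD kS => [|D] _ _ minD kS.
    by left; rewrite muln0 muln0 addn0 muln1 in kS.
  right; apply: (threshold_arith S0 (D := D.+1)).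
    by rewrite leqNgt; apply/negP => /ltnW/minD; rewrite ltnn.
  by apply: (leq_trans kS); exact: leq_mul_sqr.
case: D big large minD => [|D] big _ minD.
  by left; rewrite muln0 mul0n leqn0 muln_eq0 in big; move: big S0 k0; case: (S) => [|?]; case: (k).
right; apply: (threshold_arith S0 (D := D.+1)).
  by rewrite leqNgt; apply/negP => /ltnW/minD; rewrite ltnn.
rewrite mulnC; apply: (leq_trans big); rewrite mulnAC /c !leq_mul2r.
by rewrite (_ : (8 <= 4 * 649)%N) ?orbT.
Qed.

(** A root of order [n.+1] is taken; as C >= 1, its root is at most [C]. *)
Lemma powR_threshold {R : realType} (n C k S L : nat) : (0 < C)%N -> (0 < k)%N ->
  (k ^ n.+3 * S ^ n.+1 <= C * L ^ n.+2)%N ->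
  S%:R <= C%:R * (L%:R `^ (n.+2%:R / (n.+2%:R - 1)) / k%:R `^ ((n.+2%:R + 1) / (n.+2%:R - 1))) :> R.
Proof.
move=> C0 k0 h; pose e : R := n.+1%:R^-1.
have n1 : n.+2%:R - 1 = n.+1%:R :> R by rewrite -natr1 addrK.
have n3 : n.+2%:R + 1 = n.+3%:R :> R by rewrite natr1.
have e0 : 0 <= e by rewrite invr_ge0.
rewrite n1 n3 mulrA ler_pdivlMr ?powR_gt0 ?ltr0n// !powRrM !powR_mulrn ?ler0n//.
have -> : S%:R = (S%:R ^+ n.+1) `^ e :> R.
  by rewrite -powR_mulrn// -powRrM /e divff ?powRr1// pnatr_eq0.
rewrite -powRM ?exprn_ge0//.
apply: (@le_trans _ _ ((C%:R * L%:R ^+ n.+2) `^ e)).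
  apply: ge0_ler_powR => //; try by rewrite nnegrE mulr_ge0// exprn_ge0.
  by rewrite -!natrX -!natrM ler_nat mulnC.
rewrite powRM ?exprn_ge0// ler_wpM2r ?powR_ge0//.
rewrite -[leRHS]powRr1//; apply: ler_powR; first by rewrite ler1n.
by rewrite invf_le1 ?ltr0n// ler1n.
Qed.

Unset Implicit Arguments.

Theorem theorem3 (R : realType) (n : nat) (hn : (2 <= n)%N) :
  exists c : R,
    forall (LL : {fset set 'rV[R]_n}) (k : nat),
      (forall l, l \in LL -> is_line l) ->
      (n <= k)%N ->
      finite_set (Jk LL k) /\
      #|` fset_set (Jk LL k)|%:R <=
        c * (#|` LL|%:R `^ (n%:R / (n%:R - 1)) / k%:R `^ ((n%:R + 1) / (n%:R - 1))
             + #|` LL|%:R / k%:R).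
Proof.
case: n hn => [|[|n]]// _.
have [C C0 CE] : exists2 C : nat, (0 < C)%N & C = (1728 * (4 * 649 * n.+2 ^ 2) ^ n.+2)%N.
  by eexists; last reflexivity; rewrite muln_gt0 expn_gt0 muln_gt0.
exists (C%:R + 4) => LL k lines nk; set B := (X in _ <= _ * X).
have k0 : (0 < k)%N by exact: leq_trans nk.
have k0' : 0 < k%:R :> R by rewrite ltr0n.
(* The bound is first shown for finite subsets, since finiteness of [Jk LL k] follows from it: an
   infinite set has arbitrarily large finite subsets. *)
have bound (P : {fset 'rV[R]_n.+2}) : (forall x, x \in P -> Jk LL k x) ->
    #|` P|%:R <= (C%:R + 4) * B.
  move=> PJ.
  have B1 : 0 <= #|` LL|%:R `^ (n.+2%:R / (n.+2%:R - 1)) /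
      k%:R `^ ((n.+2%:R + 1) / (n.+2%:R - 1)) :> R.
    by rewrite divr_ge0 ?powR_ge0.
  have B2 : 0 <= #|` LL|%:R / k%:R :> R by rewrite divr_ge0.
  have le1 (x y : R) : 0 <= x -> 0 <= y -> 4 * y <= (C%:R + 4) * (x + y).
    by move=> x0 y0; have := mulr_ge0 (ler0n R C) (addr_ge0 x0 y0); lra.
  have le2 (x y : R) : 0 <= x -> 0 <= y -> C%:R * x <= (C%:R + 4) * (x + y).
    by move=> x0 y0; have := mulr_ge0 (ler0n R C) y0; lra.
  have [] := card_generic_joints_fset lines nk PJ.
    rewrite -(ler_nat R) !natrM mulrC -ler_pdivlMr// => /le_trans; apply.
    by rewrite -mulrA; exact: (le1 _ _ B1 B2).
  rewrite -CE => /(powR_threshold (R := R) C0 k0) /le_trans; apply.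
  exact: (le2 _ _ B1 B2).
have fin : finite_set (Jk LL k).
  apply: contrapT => /(infinite_set_fset (Num.trunc ((C%:R + 4) * B)).+1)[P PJ cP].
  have /bound : forall x, x \in P -> Jk LL k x by move=> x xP; exact: PJ.
  rewrite leNgt => /negP; apply.
  apply: lt_le_trans (_ : (Num.trunc ((C%:R + 4) * B)).+1%:R <= _); last by rewrite ler_nat.
  exact: truncnS_gt.
split=> //; apply: bound => x; rewrite in_fset_set// inE; exact.
Qed.
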